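(* Let $n\geq 4$ and let $(G;\{\rho_0,\ldots,\rho_{n-1}\})$ be an irreducible string C-group of rank $n$. If $\rho_0\in\langle \rho_0\rho_2,\rho_3\rangle$, then $(G;\{\rho_1,\rho_0\rho_2,\rho_3,\ldots,\rho_{n-1}\})$ (with the generators taken in the order $\rho_1,\ \rho_0\rho_2,\ \rho_3,\ \ldots,\ \rho_{n-1}$) is a string C-group of rank $n-1$.
   Context: A pair $(G;\{\rho_0,\ldots,\rho_{n-1}\})$, where $G$ is a group and $\rho_0,\ldots,\rho_{n-1}$ is an ordered sequence of elements of $G$, is a string group generated by involutions (sggi) if $G=\langle\rho_0,\ldots,\rho_{n-1}\rangle$, each $\rho_i$ is an involution (an element of order exactly 2), and the commuting property holds: for all $i,j\in\{0,\ldots,n-1\}$ with $|i-j|>1$, $(\rho_i\rho_j)^2=1$. An sggi is a string C-group, of rank $n$, if it also satisfies the intersection property: for all $I,J\subseteq\{0,\ldots,n-1\}$, $\langle\rho_i\mid i\in I\rangle\cap\langle\rho_j\mid j\in J\rangle=\langle\rho_k\mid k\in I\cap J\rangle$. It is irreducible if the order of $\rho_i\rho_{i+1}$ is greater than 2 for all $0\leq i\leq n-2$. *)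

(* Defs.v *)
From mathcomp Require Import all_boot.
From mathcomp Require Import mathcomp_extra boolp classical_sets.

Set Implicit Arguments.
Unset Strict Implicit.
Unset Printing Implicit Defensive.

Local Open Scope classical_set_scope.
Local Open Scope group_scope.

(* [group_closed] and [smallest] are library notions; [gen A] is the
   intersection of all subgroups of G that contain A.  G may be infinite. *)
Definition gen (G : groupType) (A : set G) : set G :=
  smallest (fun H : set G => group_closed [in H]) A.

Definition has_order (G : groupType) (x : G) (m : nat) : Prop :=
  [/\ (0 < m)%N, x ^+ m = 1 & forall k, (0 < k < m)%N -> x ^+ k <> 1].

(* An element of infinite order satisfies this for every m. *)
Definition order_gt (G : groupType) (x : G) (m : nat) : Prop :=
  forall k, has_order x k -> (m < k)%N.

(* The ordered generators rho_0, ..., rho_(n-1) are the items of a sequence of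
   size n; the default value 1 of [nth] is never reached. *)
Definition gen_seq (G : groupType) (n : nat) (rho : seq G) (I : set 'I_n) :
    set G :=
  gen [set nth 1 rho i | i in I].

Definition sggi (G : groupType) (n : nat) (rho : seq G) : Prop :=
  [/\ size rho = n,
      gen_seq rho [set: 'I_n] = [set: G],
      forall i : 'I_n, has_order (nth 1 rho i) 2
    & forall i j : 'I_n, (i.+1 < j)%N || (j.+1 < i)%N ->
        (nth 1 rho i * nth 1 rho j) ^+ 2 = 1].

Definition intersection_property (G : groupType) (n : nat) (rho : seq G) :
    Prop :=
  forall I J : set 'I_n,
    gen_seq rho I `&` gen_seq rho J = gen_seq rho (I `&` J).

Definition string_C_group (G : groupType) (n : nat) (rho : seq G) : Prop :=
  sggi n rho /\ intersection_property n rho.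

Definition irreducible (G : groupType) (n : nat) (rho : seq G) : Prop :=
  forall i, (i.+1 < n)%N -> order_gt (nth 1 rho i * nth 1 rho i.+1) 2.

(* Main.v *)
Require Import Defs.
From mathcomp Require Import all_boot.
From mathcomp Require Import boolp classical_sets.

Set Implicit Arguments.
Unset Strict Implicit.
Unset Printing Implicit Defensive.

Local Open Scope classical_set_scope.
Local Open Scope group_scope.

(** Write rho for the original generators and sigma for the new ones, so that
    sigma_0 = rho_1, sigma_1 = rho_0 rho_2 and sigma_j = rho_(j+1) for j >= 2.
    For a set A of indices let P(A) and Q(A) be the subgroups generated by the
    rho_i and by the sigma_i with i in A, and let A* be the set of indices of
    the rho_k that occur in some sigma_i with i in A.

    The hypothesis says that <sigma_1, sigma_2> contains rho_0, hence also
    rho_2.  So Q(A) = P( A* ), except when A contains 1 but not 2; even then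
    Q(A) is contained in P( A* ) (lemmas [merge02_sub] and [merge02_sup]).
    Taking for A the set of all indices shows that sigma generates G.

    For the intersection property let x lie in Q(A) and in Q(B).  As * commutes
    with intersections, the intersection property of rho puts x in
    P( (A cap B)* ), and this is Q(A cap B) unless A cap B contains 1 but
    not 2.  In that case, exchanging A and B if necessary, A does not contain 2.
    Removing the node 2 disconnects the diagram of sigma, and removing the node
    3 disconnects that of rho, so that x = d k = e l with d in
    Q(A cap {0, 1}), k in Q(A cap {3, ...}), e in P( (A cap B)* cap {0, 1, 2})
    and l in P( (A cap B)* cap {4, ...}).  Since P({0, 1, 2}) and P({4, ...})
    meet trivially, d = e and k = l.  The factor l is visibly in Q(A cap B), and
    so is d unless 0 lies in A but not in B.  Then d lies both in <rho_0, rho_2>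
    and in the dihedral group <rho_1, rho_0 rho_2>, and irreducibility enters:
    an element of a dihedral group <a, b> that commutes with the involution a is
    central, possibly after multiplication by a ([dihedral_centralizer]).  If
    rho_0 or rho_2 were in <rho_1, rho_0 rho_2>, then one of them would commute
    with rho_1, against irreducibility.  So d is 1 or sigma_1
    ([merge02_dihedral]). *)

(** * Subgroups generated by a set *)

Definition is_subgroup (G : groupType) (H : set G) : Prop :=
  H 1 /\ forall x y, H x -> H y -> H (x / y).

Lemma gen_min (G : groupType) (A H : set G) :
  is_subgroup H -> A `<=` H -> gen A `<=` H.
Proof.
move=> [H1 HB]; apply: smallest_sub; split=> [|x y]; rewrite !inE //.
exact: HB.
Qed.

Lemma sub_gen (G : groupType) (A : set G) : A `<=` gen A.
Proof. exact: sub_gen_smallest. Qed.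

Lemma gen_subgroup (G : groupType) (A : set G) : is_subgroup (gen A).
Proof.
split=> [H [[H1 _] _]|x y Ax Ay H HA]; first by rewrite inE in H1.
have [[_ HB] _] := HA; have := HB x y; rewrite !inE.
by apply; [exact: Ax | exact: Ay].
Qed.

Lemma gen_sub (G : groupType) (A B : set G) : A `<=` gen B -> gen A `<=` gen B.
Proof. exact: gen_min (gen_subgroup B). Qed.

Lemma is_subgroupV (G : groupType) (H : set G) x :
  is_subgroup H -> H x -> H x^-1.
Proof. by move=> [H1 HB] Hx; rewrite -div1g; apply: HB. Qed.

Lemma is_subgroupM (G : groupType) (H : set G) x y :
  is_subgroup H -> H x -> H y -> H (x * y).
Proof.
by move=> gH Hx Hy; rewrite -[y]invgK; apply: gH.2 => //; apply: is_subgroupV.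
Qed.

Lemma gen1 (G : groupType) (A : set G) : gen A 1.
Proof. exact: (gen_subgroup A).1. Qed.

Lemma genM (G : groupType) (A : set G) x y : gen A x -> gen A y -> gen A (x * y).
Proof. exact: is_subgroupM (gen_subgroup A). Qed.

Lemma genV (G : groupType) (A : set G) x : gen A x -> gen A x^-1.
Proof. exact: is_subgroupV (gen_subgroup A). Qed.

Lemma gen_set0 (G : groupType) (x : G) : gen set0 x -> x = 1.
Proof.
apply: (@gen_min _ _ [set 1]) => //.
by split=> // y z -> ->; rewrite /= divg1.
Qed.

Lemma gen_set1_involution (G : groupType) (s x : G) :
  s * s = 1 -> gen [set s] x -> x = 1 \/ x = s.
Proof.
move=> ss; have sV : s^-1 = s by apply: mulg1_eq.
apply: (@gen_min _ _ [set x | x = 1 \/ x = s]) => [|y ->]; last by right.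
split=> [|y z]; first by left.
by move=> [] -> [] ->; rewrite /= ?invg1 ?sV ?mulg1 ?mul1g ?ss; auto.
Qed.

Lemma centralizer_subgroup (G : groupType) (A : set G) :
  is_subgroup [set x | forall a, A a -> commute a x].
Proof.
split=> [a _|x y Cx Cy a Aa]; first exact: commute1.
by apply: commuteM; [exact: Cx | apply: commuteV; exact: Cy].
Qed.

Lemma gen_commute (G : groupType) (A B : set G) :
  (forall a b, A a -> B b -> commute a b) ->
  forall x y, gen A x -> gen B y -> commute x y.
Proof.
move=> cAB x y Ax By; move: y By x Ax.
apply: gen_min (centralizer_subgroup _) _ => b Bb a Aa; apply: commute_sym.
move: a Aa b Bb; apply: gen_min (centralizer_subgroup _) _ => a Aa b Bb.
exact/commute_sym/cAB.
Qed.

(** The products of an element of [gen A] and one of [gen B] form a subgroup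
    because the two factors commute. *)
Lemma gen_setU_commute (G : groupType) (A B : set G) x :
  (forall a b, A a -> B b -> commute a b) -> gen (A `|` B) x ->
  exists a b, [/\ gen A a, gen B b & x = a * b].
Proof.
move=> cAB; pose H := [set x | exists a b, [/\ gen A a, gen B b & x = a * b]].
apply: (@gen_min _ _ H) => [|y [Ay|By]]; last 2 first.
- by exists y, 1; rewrite mulg1; split=> //; [exact: sub_gen | exact: gen1].
- by exists 1, y; rewrite mul1g; split=> //; [exact: gen1 | exact: sub_gen].
split=> [|_ _ [a [b [Aa Bb ->]]] [c [d [Ac Bd ->]]]].
  by exists 1, 1; rewrite mulg1; split=> //; exact: gen1.
have cVM : commute c^-1 (b * d^-1).
  apply: (gen_commute cAB); first exact: genV.
  by apply: genM => //; apply: genV.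
exists (a * c^-1), (b * d^-1); split.
- by apply: genM => //; apply: genV.
- by apply: genM => //; apply: genV.
- by rewrite invgM -mulgA (mulgA b) -cVM !mulgA.
Qed.

(** * Centralizers in dihedral groups *)

(** Conjugating by [a] or by [b] inverts the rotation [a * b], and the elements
    that fix or invert a given element form a subgroup. *)
Lemma dihedral_rotation (G : groupType) (a b x : G) :
  a * a = 1 -> b * b = 1 -> gen [set a; b] x ->
  (a * b) ^ x = a * b \/ (a * b) ^ x = (a * b)^-1.
Proof.
move=> aa bb; set t := a * b.
have [aV bV] : a^-1 = a /\ b^-1 = b by split; apply: mulg1_eq.
have tV : t^-1 = b * a by rewrite invgM aV bV.
apply: (@gen_min _ _ [set x | t ^ x = t \/ t ^ x = t^-1]).
  split=> [|y z]; first by left; rewrite conjg1.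
  have sgnV : t ^ z = t \/ t ^ z = t^-1 -> t ^ z^-1 = t \/ t ^ z^-1 = t^-1.
    case=> tz; [left | right]; apply: (@conjg_inj _ z); rewrite conjgKV //.
    by rewrite conjVg tz invgK.
  move=> ty /sgnV tz; rewrite /= conjgM.
  by case: ty => ->; rewrite ?conjVg; case: tz => ->; rewrite ?invgK; auto.
move=> y [] ->; right; rewrite conjgE tV ?aV ?bV /t.
  by rewrite !mulgA aa mul1g.
by rewrite -(mulgA a) bb mulg1.
Qed.

(** Either [x] or [x * a] fixes the rotation [a * b] under conjugation, since
    [a] inverts it; whatever commutes with [a] and with [a * b] commutes with
    [b]. *)
Lemma dihedral_centralizer (G : groupType) (a b x : G) :
  a * a = 1 -> b * b = 1 -> gen [set a; b] x -> commute x a ->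
  commute x b \/ commute (x * a) b.
Proof.
move=> aa bb Dx xa; have aV : a^-1 = a by apply: mulg1_eq.
have fixb y : commute y a -> (a * b) ^ y = a * b -> commute y b.
  move=> ya /conjg_fixP/commgP cty; apply: (@mulgI _ a).
  by rewrite !mulgA -ya -(mulgA y) -cty.
have [tx|tx] := dihedral_rotation aa bb Dx; [left | right]; apply: fixb => //.
  exact/commute_sym/commuteM/commute_refl/commute_sym.
by rewrite conjgM tx conjgE invgM mulgVK aV (mulg1_eq bb).
Qed.

(** * Parabolic subgroups *)

(** Indexing by all of [nat] avoids ordinals of varying bounds: a finite
    sequence is read as a function that is [1] beyond its end, and these trivial
    generators do not change the subgroup. *)
Definition parabolic (G : groupType) (r : nat -> G) (A : set nat) : set G :=
  gen (r @` A).

Definition string_involutions (G : groupType) (r : nat -> G) : Prop :=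
  (forall i, r i * r i = 1) /\
  forall i j, (i.+1 < j)%N -> commute (r i) (r j).

Definition parabolic_cap (G : groupType) (r : nat -> G) : Prop :=
  forall A B, parabolic r A `&` parabolic r B `<=` parabolic r (A `&` B).

Lemma mem_parabolic (G : groupType) (r : nat -> G) A i :
  A i -> parabolic r A (r i).
Proof. by move=> Ai; apply: sub_gen; exists i. Qed.

Lemma parabolic_sub (G : groupType) (r s : nat -> G) A B :
  (forall i, A i -> parabolic s B (r i)) -> parabolic r A `<=` parabolic s B.
Proof. by move=> rs; apply: gen_sub => _ [i Ai <-]; apply: rs. Qed.

Lemma parabolic_mono (G : groupType) (r : nat -> G) A B :
  A `<=` B -> parabolic r A `<=` parabolic r B.
Proof. by move=> AB; apply: parabolic_sub => i /AB; apply: mem_parabolic. Qed.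

Lemma parabolic_split (G : groupType) (r : nat -> G) A B C x :
  (forall i j, B i -> C j -> commute (r i) (r j)) -> A `<=` B `|` C ->
  parabolic r A x ->
  exists b c, [/\ parabolic r (A `&` B) b, parabolic r (A `&` C) c & x = b * c].
Proof.
move=> cBC ABC Ax;
  apply: gen_setU_commute => [_ _ [i [_ Bi] <-] [j [_ Cj] <-]|].
  exact: cBC.
rewrite -image_setU -setIUr; apply: parabolic_mono Ax => i Ai.
by split=> //; apply: ABC.
Qed.

(** * Replacing the first and third generators by their product *)

Definition merge02 (G : groupType) (r : nat -> G) (i : nat) : G :=
  match i with 0 => r 1%N | 1 => r 0%N * r 2%N | j.+2 => r j.+3 end.

(** The original generator [r k] is a factor of exactly one new generator, the
    one of index [origin k]; hence the set A* of the introduction is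
    [origin @^-1` A], and it commutes with intersections by definition. *)
Definition origin (k : nat) : nat :=
  match k with 0 => 1%N | 1 => 0%N | 2 => 1%N | j.+3 => j.+2 end.

Lemma merge02_sub (G : groupType) (r : nat -> G) A :
  parabolic (merge02 r) A `<=` parabolic r (origin @^-1` A).
Proof.
apply: parabolic_sub => -[|[|j]] Aj /=; first exact: mem_parabolic.
  by apply: genM; apply: mem_parabolic.
exact: mem_parabolic.
Qed.

(** The involution [r 0] turns [r 0 * r 2] into [r 2]. *)
Lemma merge02_factors (G : groupType) (r : nat -> G) A :
  string_involutions r -> gen [set r 0%N * r 2%N; r 3%N] (r 0%N) ->
  A 1%N -> A 2%N ->
  parabolic (merge02 r) A (r 0%N) /\ parabolic (merge02 r) A (r 2%N).
Proof.
move=> [rr _] r0 A1 A2.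
have Q1 : parabolic (merge02 r) A (r 0%N * r 2%N).
  exact: (@mem_parabolic _ (merge02 r) _ 1%N).
have Q0 : parabolic (merge02 r) A (r 0%N).
  apply: gen_sub r0 => _ [] -> //.
  exact: (@mem_parabolic _ (merge02 r) _ 2%N).
by split=> //; rewrite -[r 2%N]mul1g -(rr 0%N) -mulgA; apply: genM.
Qed.

Lemma merge02_sup (G : groupType) (r : nat -> G) A :
  string_involutions r -> gen [set r 0%N * r 2%N; r 3%N] (r 0%N) ->
  (A 1%N -> A 2%N) ->
  parabolic r (origin @^-1` A) `<=` parabolic (merge02 r) A.
Proof.
move=> sr r0 A12; have pair A1 := merge02_factors sr r0 A1 (A12 A1).
apply: parabolic_sub => -[|[|[|j]]] /= Aj.
- by have [] := pair Aj.
- exact: (@mem_parabolic _ (merge02 r) _ 0%N).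
- by have [] := pair Aj.
- exact: (@mem_parabolic _ (merge02 r) _ j.+2).
Qed.

(** The subgroup generated by [r 0] and [r 2] contains, besides [1] and
    [r 0 * r 2], only [r 0] and [r 2].  With [a = r 0 * r 2] both
    [r 0 * a = r 2] and [r 2 * a = r 0], so if either were in the dihedral group
    generated by [a] and [r 1], then [dihedral_centralizer] would make [r 0] or
    [r 2] commute with [r 1], which is excluded. *)
Lemma merge02_dihedral (G : groupType) (r : nat -> G) x :
  string_involutions r ->
  ~ commute (r 0%N) (r 1%N) -> ~ commute (r 1%N) (r 2%N) ->
  parabolic r [set 0%N; 2%N] x -> parabolic (merge02 r) [set 0%N; 1%N] x ->
  x = 1 \/ x = r 0%N * r 2%N.
Proof.
move=> [rr rC] nc01 nc12 Px Qx.
have c02 : commute (r 0%N) (r 2%N) by apply: rC.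
have [r0a ar2] :
    r 2%N = r 0%N * (r 0%N * r 2%N) /\ r 0%N = r 2%N * (r 0%N * r 2%N).
  by split; [rewrite mulgA rr mul1g | rewrite c02 mulgA rr mul1g].
set a := r 0%N * r 2%N in r0a ar2 *.
have aa : a * a = 1 by rewrite {1}/a c02 -mulgA -r0a.
have ca i : i = 0%N \/ i = 2%N -> commute (r i) a.
  case=> ->; apply: commuteM => //; try exact: commute_refl.
have no i : i = 0%N \/ i = 2%N -> x <> r i.
  move=> i02 xi; have Dx : gen [set a; r 1%N] (r i).
    rewrite -xi; apply: gen_sub Qx => _ [j [] -> <-]; apply: sub_gen.
      by right.
    by left.
  case: (dihedral_centralizer aa (rr 1%N) Dx (ca i i02)); case: i02 => ->.
  - by [].
  - by move/commute_sym.
  - by rewrite -r0a => /commute_sym.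
  - by rewrite -ar2.
have /gen_setU_commute[|u [v [Pu Pv xE]]] : gen ([set r 0%N] `|` [set r 2%N]) x.
- by move: Px; rewrite /parabolic image_setU !image_set1.
- by move=> _ _ -> ->.
have := no 0%N; have := no 2%N; rewrite xE.
have [] := gen_set1_involution (rr 0%N) Pu => ->;
  have [] := gen_set1_involution (rr 2%N) Pv => -> /=; rewrite ?mulg1 ?mul1g; auto.
- by move=> /(_ (or_intror erefl)).
- by move=> _ /(_ (or_introl erefl)).
Qed.

(** A new parabolic subgroup can fail to be an old one only if its index set
    has [1] but not [2]; it then splits as a direct product along the missing
    index, and comparing this splitting with that of the ambient old parabolic
    subgroup reduces the claim to [merge02_dihedral]. *)
Lemma merge02_cap (G : groupType) (r : nat -> G) :
  string_involutions r -> parabolic_cap r ->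
  ~ commute (r 0%N) (r 1%N) -> ~ commute (r 1%N) (r 2%N) ->
  gen [set r 0%N * r 2%N; r 3%N] (r 0%N) ->
  parabolic_cap (merge02 r).
Proof.
move=> sr rI nc01 nc12 r0 A B x [QAx QBx].
have PABx : parabolic r (origin @^-1` (A `&` B)) x.
  by apply: rI; split; apply: merge02_sub.
have [AB12|/not_implyP[[A1 B1] nAB2]] := pselect ((A `&` B) 1%N -> (A `&` B) 2%N).
  exact: merge02_sup PABx.
wlog nA2 : A B QAx QBx PABx A1 B1 nAB2 / ~ A 2%N.
  move=> IH; have [A2|] := pselect (A 2%N); last exact: IH.
  by rewrite setIC; apply: IH => //; rewrite 1?setIC // => B2; apply: nAB2.
have [rr rC] := sr.
(* As [2] is not in [A], the diagram of the new generators splits there. *)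
have [d [k [Qd Qk xdk]]] : exists d k,
    [/\ parabolic (merge02 r) (A `&` [set i | (i < 2)%N]) d,
        parabolic (merge02 r) (A `&` [set i | (2 < i)%N]) k & x = d * k].
  apply: parabolic_split QAx => [[|[|i]] [|[|[|j]]] //= _ _|i Ai].
  - exact: rC.
  - by apply/commute_sym/commuteM; apply/commute_sym/rC.
  - by case: (ltngtP i 2) => [||i2]; [left | right | rewrite i2 in Ai].
(* The old index [3] has origin [2], so it is missing on this side. *)
have [e [l [Pe Pl xel]]] : exists e l,
    [/\ parabolic r (origin @^-1` (A `&` B) `&` [set i | (i < 3)%N]) e,
        parabolic r (origin @^-1` (A `&` B) `&` [set i | (3 < i)%N]) l &
        x = e * l].
  apply: parabolic_split PABx => [i j /= i3 j3|i ABi].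
    by apply: rC; apply: leq_trans j3.
  by case: (ltngtP i 3) => [||i3]; [left | right | case: nAB2; rewrite i3 in ABi].
(* Both factorizations take place in the same direct product. *)
have Pd : parabolic r [set i | (i < 3)%N] d.
  move/merge02_sub: Qd; apply: parabolic_mono.
  by case=> [|[|[|i]]] [].
have Pk : parabolic r [set i | (3 < i)%N] k.
  move/merge02_sub: Qk; apply: parabolic_mono.
  by case=> [|[|[|[|i]]]] [].
have edlk : e^-1 * d = l / k.
  by apply: (@mulgI _ e); rewrite mulVKg mulgA -xel xdk mulgK.
have ed1 : e^-1 * d = 1.
  apply: gen_set0; rewrite -(image_set0 r).
  have -> : set0 = [set i | (i < 3)%N] `&` [set i | (3 < i)%N].
    apply/esym/seteqP; split=> // i [/= i3 /(ltn_trans i3)].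
    by rewrite ltnn.
  apply: rI; split.
    by apply: genM => //; apply: genV; apply: parabolic_mono Pe => i [].
  rewrite edlk; apply: genM; last exact: genV.
  by apply: parabolic_mono Pl => i [].
have de : d = e by rewrite -[d](mulVKg e) ed1 mulg1.
have kl : k = l by apply/esym/divg1_eq; rewrite -edlk.
rewrite xdk; apply: genM; last first.
  rewrite kl; apply: (@parabolic_mono _ _ ((A `&` B) `&` [set i | (2 < i)%N])).
    by move=> i [].
  apply: merge02_sup => //; first by case.
  apply: parabolic_mono Pl => -[|[|[|[|i]]]] //= [].
(* If [0] is in [A] only, then [d = e] is in the span of [r 0] and [r 2]. *)
have [B0|nB0] := pselect (A 0%N -> B 0%N).
  by apply: parabolic_mono Qd => -[|[|i]] [Ai /= lt_i2] //; split=> //; apply: B0.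
have [] := @merge02_dihedral _ r d sr nc01 nc12.
- rewrite de; apply: parabolic_mono Pe => -[|[|[|i]]] [[/= A0 B0] i3] //; auto.
- by apply: parabolic_mono Qd => -[|[|i]] [/= _ i2] //; auto.
- by move=> ->; apply: gen1.
- by move=> ->; apply: (@mem_parabolic _ (merge02 r) _ 1%N).
Qed.

(** * Generating sequences *)

Lemma gen_seqE (G : groupType) n (s : seq G) (I : set 'I_n) :
  gen_seq s I = parabolic (nth 1 s) (@nat_of_ord n @` I).
Proof. by rewrite /gen_seq /parabolic image_comp. Qed.

Lemma parabolic_gen_seq (G : groupType) n (s : seq G) (A : set nat) :
  size s = n ->
  parabolic (nth 1 s) A = gen_seq s [set i : 'I_n | A i].
Proof.
move=> sz; rewrite gen_seqE; apply/seteqP; split; last first.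
  by apply: parabolic_mono => _ [i Ai <-].
apply: parabolic_sub => i Ai; have [lt_in|] := ltnP i n.
  by apply: mem_parabolic; exists (Ordinal lt_in).
by rewrite -sz => /(nth_default 1) ->; apply: gen1.
Qed.

Lemma intersection_propertyP (G : groupType) n (s : seq G) :
  size s = n -> intersection_property n s <-> parabolic_cap (nth 1 s).
Proof.
move=> sz; split=> [IP A B x|IP I J].
  by rewrite !(parabolic_gen_seq _ sz) IP.
apply/seteqP; split=> [|x]; rewrite !gen_seqE.
  apply: (subset_trans (IP _ _));
  apply: parabolic_mono => _ [[i Ii <-] [j Jj ij]].
  by exists i => //; split=> //; rewrite -(ord_inj ij).
by move=> PIJ; split; apply: parabolic_mono PIJ => _ [i [Ii Ji] <-]; exists i.
Qed.

Lemma has_order2P (G : groupType) (x : G) :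
  has_order x 2 <-> x <> 1 /\ x * x = 1.
Proof.
split=> [[_ xx /(_ 1%N)]|[nx1 xx]].
  by rewrite expg1 => nx1; split=> //; exact: nx1.
by split=> // -[|[|k]].
Qed.

Lemma commute_involutionsP (G : groupType) (x y : G) :
  x * x = 1 -> y * y = 1 -> (x * y) ^+ 2 = 1 <-> commute x y.
Proof.
move=> xx yy; rewrite expg2; split=> [xy|xy]; last first.
  by rewrite {2}xy mulgA -(mulgA x) yy mulg1.
by rewrite /commute -(mulg1_eq xy) invgM (mulg1_eq xx) (mulg1_eq yy).
Qed.

Lemma sggi_string_involutions (G : groupType) n (s : seq G) :
  sggi n s -> string_involutions (nth 1 s).
Proof.
move=> [sz _ ord2 far].
have invo i : nth 1 s i * nth 1 s i = 1.
  have [lt_in|] := ltnP i n; first by have /has_order2P[] := ord2 (Ordinal lt_in).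
  by rewrite -sz => /(nth_default 1) ->; rewrite mulg1.
split=> // i j ij; have [lt_jn|] := ltnP j n; last first.
  by rewrite -sz => /(nth_default 1) ->; apply: commute1.
have lt_in : (i < n)%N by apply: leq_trans lt_jn; apply: ltnW; apply: ltnW.
apply/commute_involutionsP => //.
by apply: (far (Ordinal lt_in) (Ordinal lt_jn)); rewrite /= ij.
Qed.

(** Commuting involutions have a product of order 1 or 2; order 1 occurs when
    they are equal. *)
Lemma order_gt2_noncommute (G : groupType) (x y : G) :
  x * x = 1 -> y * y = 1 -> order_gt (x * y) 2 -> ~ commute x y.
Proof.
move=> xx yy gt2 /(commute_involutionsP xx yy) xy2.
have [xy1|nxy1] := pselect (x * y = 1); last first.
  by have /gt2 : has_order (x * y) 2 by apply/has_order2P.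
by have /gt2 : has_order (x * y) 1 by split=> // -[|k].
Qed.

Lemma nth_merge02 (G : groupType) (s : seq G) :
  nth 1 [:: nth 1 s 1, nth 1 s 0 * nth 1 s 2 & drop 3 s] = merge02 (nth 1 s).
Proof. by apply/funext => -[|[|j]] //=; rewrite nth_drop. Qed.

Theorem theorem1p1 (G : groupType) (n : nat) (rho : seq G)
    (n_ge4 : (4 <= n)%N)
    (rho_C : string_C_group n rho)
    (rho_irr : irreducible n rho)
    (rho0_in : gen [set nth 1%g rho 0 * nth 1%g rho 2; nth 1%g rho 3]%g%classic
                 (nth 1%g rho 0)) :
  string_C_group n.-1
    [:: nth 1%g rho 1, (nth 1%g rho 0 * nth 1%g rho 2)%g & drop 3 rho].
Proof.
have [rho_sggi rho_IP] := rho_C; have [sz gen_rho ord2 _] := rho_sggi.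
have sr := sggi_string_involutions rho_sggi; have [rr rC] := sr.
have rI : parabolic_cap (nth 1 rho) by apply: (intersection_propertyP sz).1.
have nc i : (i.+1 < n)%N -> ~ commute (nth 1 rho i) (nth 1 rho i.+1).
  by move=> lt_in; apply: order_gt2_noncommute => //; apply: rho_irr.
have nt i : (i < n)%N -> nth 1 rho i <> 1.
  by move=> lt_in; have /has_order2P[] := ord2 (Ordinal lt_in).
have c02 : commute (nth 1 rho 0) (nth 1 rho 2) by apply: rC.
have n02 : nth 1 rho 0 * nth 1 rho 2 <> 1.
  (* Otherwise [nth 1 rho 0 = nth 1 rho 2], which the intersection property
     forces to be [1]. *)
  move=> r02; apply: (nt 0%N); first exact: leq_trans n_ge4.
  have r20 : nth 1 rho 2 = nth 1 rho 0.
    by rewrite -(mulg1_eq r02) (mulg1_eq (rr 0%N)).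
  apply: gen_set0; rewrite -(image_set0 (nth 1 rho)).
  have -> : set0 = [set 0%N] `&` [set 2%N].
    by apply/esym/seteqP; split=> // i [->].
  apply: rI; split; first exact: mem_parabolic.
  by rewrite -r20; apply: mem_parabolic.
have sz' : size [:: nth 1 rho 1, nth 1 rho 0 * nth 1 rho 2 & drop 3 rho] = n.-1.
  rewrite /= size_drop sz; case: (n) n_ge4 => [|[|[|m]]] // _.
  by rewrite !subSS subn0.
split; last first.
  apply: (intersection_propertyP sz').2; rewrite nth_merge02.
  by apply: merge02_cap => //; apply: nc; apply: leq_trans n_ge4.
have invo i : merge02 (nth 1 rho) i * merge02 (nth 1 rho) i = 1.
  case: i => [|[|i]] //=.
  by rewrite {2}c02 mulgA -(mulgA (nth 1 rho 0)) rr mulg1 rr.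
split=> //; rewrite ?nth_merge02.
- have := parabolic_gen_seq setT sz'; rewrite nth_merge02 => <-.
  (* The set of all indices contains [2]. *)
  rewrite -subTset => x _; apply: merge02_sup => //.
  by rewrite (parabolic_gen_seq _ sz) gen_rho.
- move=> i; apply/has_order2P; split=> //.
  case: i => -[|[|i]] //= lt_in; apply: nt; first exact: leq_trans n_ge4.
  by rewrite -ltn_predRL.
- have far i j : (i.+1 < j)%N ->
      commute (merge02 (nth 1 rho) i) (merge02 (nth 1 rho) j).
    case: i j => [|[|i]] [|[|j]] //= ij; try exact: rC.
    by apply/commute_sym/commuteM; apply/commute_sym/rC.
  move=> i j /orP[|] ij; apply/commute_involutionsP => //; first exact: far.
  exact/commute_sym/far.
Qed.
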